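(* Let $K$ be a field, let $f,g,h\in K[x]$ with $f=g\circ h$, and let $t$ be an indeterminate. Then there exists $a\in K$ such that $$D[f-t]=a\,D[g-t]^{\deg h}\,\operatorname{Res}_x\big(f(x)-t,\,h'(x)\big),$$ where $f-t$ and $g-t$ are regarded as polynomials in $x$ with coefficients in $K[t]$.
   Context: For polynomials $u(x)=a_nx^n+\cdots+a_0$ and $v(x)=b_mx^m+\cdots+b_0$ (with $a_n,b_m\neq0$) over a field, the resultant is $\operatorname{Res}_x(u,v)=a_n^m b_m^n\prod_{\alpha,\beta}(\alpha-\beta)$, where $\alpha$ and $\beta$ run over the roots (with multiplicity) of $u$ and $v$ respectively in an algebraic closure. The discriminant of $u$ of degree $n$ with leading coefficient $a_n$ is $D[u]=\frac{(-1)^{n(n-1)/2}}{a_n}\operatorname{Res}_x(u,u')$, where $u'$ is the derivative with respect to $x$. For $u-t$ these are computed over (an algebraic closure of) $K(t)$ and yield polynomials in $t$. *)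

(* Defs.v *)
From HB Require Import structures.
From mathcomp Require Import all_boot all_order all_algebra.

Set Implicit Arguments.
Unset Strict Implicit.
Unset Printing Implicit Defensive.

Import GRing.Theory.
Local Open Scope ring_scope.

Section RootsOverClosedField.

Variable L : closedFieldType.
Implicit Types u v : {poly L}.

Definition degree (R : nzRingType) (p : {poly R}) : nat := (size p).-1.

(* The roots of u listed with multiplicity (meaningful for u != 0):          *)
(* u = lead_coef u *: \prod_(z <- roots u) ('X - z%:P).                      *)
Definition roots u : seq L := sval (closed_field_poly_normal u).

(* MathComp's [resultant] is the Sylvester determinant with the coefficients *)
(* in increasing order, which differs from the root product below by the     *)
(* sign (-1) ^ (deg u * deg v).  The root product only makes sense for       *)
(* nonzero u and v; otherwise the resultant is taken to be 0, so that a      *)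
(* polynomial with zero derivative has zero discriminant.                    *)
Definition Res u v : L :=
  if (u == 0) || (v == 0) then 0 else
  lead_coef u ^+ degree v * lead_coef v ^+ degree u *
  \prod_(alpha <- roots u) \prod_(beta <- roots v) (alpha - beta).

(* The degree of v in [Res u v] is its actual degree, so in positive         *)
(* characteristic deg u' may be smaller than deg u - 1.                      *)
Definition Disc u : L :=
  (-1) ^+ (degree u * (degree u).-1)./2 / lead_coef u * Res u u^`().

End RootsOverClosedField.

Definition is_alg_closure (F : fieldType) (L : closedFieldType)
    (iota : {rmorphism F -> L}) : Prop :=
  forall z : L, algebraicOver iota z.

(* Elements of K[t][x] are {poly {poly K}}: the outer variable is x and the  *)
(* inner one is t, so that t is 'X%:P and p^:P is p(x) with p in K[x].       *)
Definition sub_t (K : fieldType) (p : {poly K}) : {poly {poly K}} :=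
  p^:P - 'X%:P.

(* K[t] -> K(t) -> L *)
Definition embed (K : fieldType) (L : closedFieldType)
    (iota : {rmorphism {fraction {poly K}} -> L}) (c : {poly K}) : L :=
  iota (tofrac c).

(* Main.v *)
Require Import Defs.
From HB Require Import structures.
From mathcomp Require Import all_boot all_order all_algebra ring.

Set Implicit Arguments.
Unset Strict Implicit.
Unset Printing Implicit Defensive.

Import GRing.Theory.
Local Open Scope ring_scope.

(** [Res_x(u, v)] is [lc u ^ deg v] times the product of [v(alpha)] over the
    roots [alpha] of [u], so it is multiplicative in [v].  The roots of [g \o h]
    are the roots of all [h - gamma] with [gamma] a root of [g], each giving
    [deg h] roots on which [v \o h] is the constant [v(gamma)]; hence
    [Res(g \o h, v \o h)] is [Res(g, v) ^ deg h] up to a power of [lc h].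
    Apply both facts to the chain rule [(g \o h)' = (g' \o h) * h'].  The
    resulting factor depends on [g - t] only through its degree, its derivative
    and its leading coefficient, none of which involves [t] unless [g] is
    constant, when both sides vanish. *)

Section Resultant.

Variable L : closedFieldType.
Implicit Types u v w : {poly L}.

Lemma roots_prod u : u = lead_coef u *: \prod_(z <- Defs.roots u) ('X - z%:P).
Proof. exact: svalP (closed_field_poly_normal u). Qed.

Lemma size_roots u : u != 0 -> size (Defs.roots u) = degree u.
Proof.
move=> u0; rewrite /degree {2}(roots_prod u) size_scale ?lead_coef_eq0 //.
by rewrite size_prod_XsubC.
Qed.

Lemma horner_roots u x : u.[x] = lead_coef u * \prod_(z <- Defs.roots u) (x - z).
Proof.
rewrite {1}(roots_prod u) hornerZ horner_prod; congr (_ * _).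
by apply: eq_bigr => z _; rewrite hornerXsubC.
Qed.

(** For each root of [u], one of the [degree u] factors [lead_coef v] completes the inner product to
    a value of [v]. *)
Lemma Res_horner u v : u != 0 -> v != 0 ->
  Res u v = lead_coef u ^+ degree v * \prod_(z <- Defs.roots u) v.[z].
Proof.
move=> u0 v0; rewrite /Res (negPf u0) (negPf v0) /= -mulrA; congr (_ * _).
under [RHS]eq_bigr do rewrite horner_roots.
by rewrite big_split /= big_const_seq count_predT iter_mulr_1 size_roots.
Qed.

Lemma Res0r u : Res u 0 = 0.
Proof. by rewrite /Res eqxx orbT. Qed.

Lemma Res0l v : Res 0 v = 0.
Proof. by rewrite /Res eqxx. Qed.

Lemma degreeM v w : v != 0 -> w != 0 ->
  degree (v * w) = (degree v + degree w)%N.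
Proof.
move=> v0 w0; rewrite /degree size_mul //.
move: v0 w0; rewrite -!size_poly_gt0.
by case: (size v) => // m; case: (size w) => // n; rewrite addnS addSn.
Qed.

Lemma ResM u v w : u != 0 -> Res u (v * w) = Res u v * Res u w.
Proof.
move=> u0; have [->|v0] := eqVneq v 0; first by rewrite mul0r Res0r mul0r.
have [->|w0] := eqVneq w 0; first by rewrite mulr0 Res0r mulr0.
rewrite !Res_horner ?mulf_neq0 // degreeM // exprD mulrACA -big_split /=.
by congr (_ * _); apply: eq_bigr => z _; rewrite hornerM.
Qed.

Variable h : {poly L}.
Hypothesis h_gt1 : (1 < size h)%N.

Lemma lead_coef_subC c : lead_coef (h - c%:P) = lead_coef h.
Proof.
by rewrite lead_coefDl // size_polyN (leq_ltn_trans (size_polyC_leq1 c)).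
Qed.

Lemma size_subC c : size (h - c%:P) = size h.
Proof.
by rewrite size_polyDl // size_polyN (leq_ltn_trans (size_polyC_leq1 c)).
Qed.

Lemma comp_poly_neq0 u : u != 0 -> u \Po h != 0.
Proof.
move=> u0; rewrite -lead_coef_eq0 lead_coef_comp // mulf_neq0 //.
  by rewrite lead_coef_eq0.
by rewrite expf_neq0 // lead_coef_eq0 -size_poly_gt0 ltnW.
Qed.

Lemma roots_comp u : u != 0 ->
  perm_eq (Defs.roots (u \Po h))
    (flatten [seq Defs.roots (h - c%:P) | c <- Defs.roots u]).
Proof.
move=> u0; apply: prod_XsubC_eq.
have l0 : lead_coef (u \Po h) != 0 by rewrite lead_coef_eq0 comp_poly_neq0.
(* After scaling by the leading coefficient of [u \Po h], which is
   [lead_coef u * lead_coef h ^+ degree u], each root [c] of [u] receives one [lead_coef h], just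
   what turns the monic product over the roots of [h - c%:P] into [h - c%:P]. *)
apply: (scalerI l0); rewrite -roots_prod big_flatten big_map.
rewrite lead_coef_comp // -/(degree u) -size_roots //.
rewrite {1}(roots_prod u) comp_polyZ rmorph_prod /= -scalerA; congr (_ *: _).
rewrite -(count_predT (Defs.roots u)) -iter_mulr_1 -big_const_seq -scaler_prod.
apply: eq_bigr => c _.
by rewrite rmorphB /= comp_polyX comp_polyC {1}(roots_prod (h - c%:P))
  lead_coef_subC.
Qed.

Lemma Res_comp u v : Res (u \Po h) (v \Po h) =
  lead_coef h ^+ (degree u * degree h * degree v) * Res u v ^+ degree h.
Proof.
have k0 : degree h != 0%N by rewrite /degree -lt0n -ltnS prednK // ltnW.
have [->|u0] := eqVneq u 0.
  by rewrite comp_poly0 !Res0l expr0n (negPf k0) mulr0.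
have [->|v0] := eqVneq v 0.
  by rewrite comp_poly0 !Res0r expr0n (negPf k0) mulr0.
rewrite !Res_horner ?comp_poly_neq0 // (perm_big _ (roots_comp u0)) big_flatten.
rewrite big_map lead_coef_comp // -/(degree u) /degree size_comp_poly.
rewrite -!/(degree _) [X in _ * X = _](_ : _ =
  (\prod_(c <- Defs.roots u) v.[c]) ^+ degree h); last first.
  rewrite -prodrXl; apply: eq_bigr => c _.
  have hc0 : h - c%:P != 0 by rewrite -size_poly_gt0 size_subC ltnW.
  rewrite /degree -(size_subC c) -/(degree _) -size_roots //.
  rewrite -(count_predT (Defs.roots _)) -iter_mulr_1 -big_const_seq big_seq.
  rewrite [RHS]big_seq; apply: eq_bigr => z z_root.
  suff /eqP : (h - c%:P).[z] = 0.
    by rewrite hornerD hornerN hornerC subr_eq0 horner_comp => /eqP ->.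
  rewrite horner_roots; apply/eqP; rewrite mulf_eq0; apply/orP; right.
  by rewrite (big_rem z) //= subrr mul0r.
rewrite exprMn exprMn -!exprM mulrA; congr (_ * _).
by rewrite mulrC; congr (_ ^+ _ * _ ^+ _);
  rewrite ?mulnA mulnC // mulnCA mulnA.
Qed.

End Resultant.

Definition disc_sign (R : pzRingType) (n : nat) : R := (-1) ^+ (n * n.-1)./2.

(** Collects the signs and leading coefficients of both discriminants and the power of [lh] from
    [Res_comp]. Here [d] stands for the degree of the derivative, which may drop below [n.-1] in
    positive characteristic. The ring is left general so that the formula can be read in [K] and in
    [L]. *)
Definition disc_comp_factor (R : unitRingType) (n k d : nat) (lg lh : R) : R :=
  disc_sign R (n * k) * disc_sign R n ^+ k * lg ^+ k / (lg * lh ^+ n) *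
  lh ^+ (n * k * d).

Lemma rmorph_disc_comp_factor (F E : fieldType) (phi : {rmorphism F -> E})
    n k d lg lh :
  phi (disc_comp_factor n k d lg lh) = disc_comp_factor n k d (phi lg) (phi lh).
Proof.
by rewrite !(rmorphM, fmorphV, rmorphXn, rmorphN1).
Qed.

Lemma Disc_comp (L : closedFieldType) (g h : {poly L}) :
  g != 0 -> (1 < size h)%N ->
  Disc (g \Po h) =
    disc_comp_factor (degree g) (degree h) (degree g^`())
      (lead_coef g) (lead_coef h) *
    Disc g ^+ degree h * Res (g \Po h) h^`().
Proof.
move=> g0 h_gt1.
have lg0 : lead_coef g != 0 by rewrite lead_coef_eq0.
rewrite /Disc deriv_comp ResM ?comp_poly_neq0 // Res_comp //.
rewrite lead_coef_comp // [degree (_ \Po _)]size_comp_poly -!/(degree _).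
rewrite /disc_comp_factor -!/(disc_sign _ _).
(* A sign is its own inverse: this square and [lgk] supply the factors needed to form
   [Disc g ^+ degree h]. *)
have sg : disc_sign L (degree g) ^+ degree h *
    disc_sign L (degree g) ^+ degree h = 1.
  by rewrite -exprMn /disc_sign -exprMn mulrNN mulr1 !expr1n.
have lgk : lead_coef g ^+ degree h != 0 by rewrite expf_neq0.
rewrite !exprMn exprVn.
by rewrite -[LHS]mul1r -{1}sg -[LHS]mul1r -(divff lgk); ring.
Qed.

Section Embedding.

Variables (K : fieldType) (L : closedFieldType).
Variable iota : {rmorphism {fraction {poly K}} -> L}.

Let phi : {rmorphism K -> L} := iota \o (@tofrac {poly K}) \o polyC.
(** The function [embed iota], equipped with its morphism structure. *)
Let emb : {rmorphism {poly K} -> L} := iota \o (@tofrac {poly K}).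

Lemma map_embed_lift (p : {poly K}) :
  map_poly (embed iota) p^:P = map_poly phi p.
Proof. by rewrite -[embed iota]/(emb : _ -> _) -map_poly_comp. Qed.

Lemma map_embed_sub_t (p : {poly K}) :
  map_poly (embed iota) (sub_t p) = map_poly phi p - (embed iota 'X)%:P.
Proof.
by rewrite -map_embed_lift -[embed iota]/(emb : _ -> _) rmorphB /= map_polyC.
Qed.

Lemma deriv_map_sub_t (p : {poly K}) :
  (map_poly (embed iota) (sub_t p))^`() = map_poly phi p^`().
Proof. by rewrite map_embed_sub_t derivB derivC subr0 deriv_map. Qed.

End Embedding.

Theorem theorem4p1 (K : fieldType) (f g h : {poly K}) (hf : f = g \Po h) :
  exists a : K,
    forall (L : closedFieldType) (iota : {rmorphism {fraction {poly K}} -> L}),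
      is_alg_closure iota ->
      Disc (map_poly (embed iota) (sub_t f)) =
        embed iota a%:P *
        Disc (map_poly (embed iota) (sub_t g)) ^+ degree h *
        Res (map_poly (embed iota) (sub_t f))
            (map_poly (embed iota) (h^`())^:P).
Proof.
(* The witness is built from data over [K] alone, hence serves every [L] and [iota]. *)
exists (disc_comp_factor (degree g) (degree h) (degree g^`())
          (lead_coef g) (lead_coef h)) => L iota _.
pose phi : {rmorphism K -> L} := iota \o (@tofrac {poly K}) \o polyC.
have deriv_gt1 (p : {poly K}) : p^`() != 0 -> (1 < size p)%N.
  by apply: contraNltn => /size1_polyC ->; rewrite derivC.
rewrite map_embed_lift -/phi.
(* If [h] has zero derivative, so has [f] by the chain rule, and both sides are resultants against
   0. *)
have [h'0|/deriv_gt1 h_gt1] := eqVneq h^`() 0.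
  rewrite h'0 rmorph0 Res0r mulr0 /Disc deriv_map_sub_t hf deriv_comp h'0.
  by rewrite mulr0 rmorph0 Res0r mulr0.
have k0 : degree h != 0%N by rewrite /degree -lt0n -ltnS prednK // ltnW.
(* Both discriminants vanish here, and the power on the right stays 0 because [degree h] is
   positive. *)
have [g'0|/deriv_gt1 g_gt1] := eqVneq g^`() 0.
  rewrite /Disc !deriv_map_sub_t hf deriv_comp g'0 comp_poly0 mul0r rmorph0.
  by rewrite !Res0r !mulr0 expr0n (negPf k0) mulr0 mul0r.
have g_map_gt1 : (1 < size (map_poly phi g))%N by rewrite size_map_poly.
have h_map_gt1 : (1 < size (map_poly phi h))%N by rewrite size_map_poly.
(* Composition with [h] fixes the constant [t], so [f - t] is [g - t] composed with [h]. *)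
have -> : map_poly (embed iota) (sub_t f) =
    map_poly (embed iota) (sub_t g) \Po map_poly phi h.
  by rewrite !map_embed_sub_t -/phi rmorphB /= comp_polyC hf map_comp_poly.
have deg_g : degree (map_poly (embed iota) (sub_t g)) = degree g.
  by rewrite /degree map_embed_sub_t size_subC // size_map_poly.
have lead_g : lead_coef (map_poly (embed iota) (sub_t g)) = phi (lead_coef g).
  by rewrite map_embed_sub_t lead_coef_subC // lead_coef_map.
rewrite Disc_comp //; last first.
  by rewrite -lead_coef_eq0 lead_g fmorph_eq0 lead_coef_eq0 -size_poly_gt0 ltnW.
rewrite deriv_map_sub_t -/phi deg_g lead_g deriv_map lead_coef_map.
rewrite [degree (map_poly phi h)]/degree [degree (map_poly phi _)]/degree.
by rewrite !size_map_poly -!/(degree _) -rmorph_disc_comp_factor.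
Qed.
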